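(* Suppose that for all $i=1,\ldots,n$ $$\min\left(\kappa_i(u_{i+1}-u_i),\ \kappa_{i-1}(u_i-u_{i-1})\right)+2d_i\ge 0,$$ where $\kappa_i=k_i/a_i^2$. Then there exists a unique increasing self-similar solution (of the form given in the context) of the multi-phase Stefan problem with Riemann initial data described in the context.
   Context: Let $n\ge 1$ be an integer, let $u_-=u_0<u_1<\cdots<u_n<u_{n+1}=u_+$ be real numbers (the $u_i$, $1\le i\le n$, are phase transition temperatures), let $a_i>0$ and $k_i>0$ for $i=0,\ldots,n$, and let $d_i\in\mathbb{R}$ for $i=1,\ldots,n$ be real numbers (of any sign). The Stefan problem in the half-plane $\{(t,x): t>0,\ x\in\mathbb{R}\}$: find $u(t,x)$ and phase transition lines $x=x_i(t)$, $i=1,\ldots,n$, on which $u=u_i$, such that (a) $u_t=a_i^2u_{xx}$ in the region where $u_i<u<u_{i+1}$, $i=0,\ldots,n$; (b) $d_i x_i'(t)+k_iu_x(t,x_i(t)+)-k_{i-1}u_x(t,x_i(t)-)=0$ on $x=x_i(t)$, $i=1,\ldots,n$ (Stefan condition, with one-sided derivatives); (c) $u(0,x)=u_-$ for $x<0$ and $u(0,x)=u_+$ for $x>0$ (as the limit as $t\to0+$). Let $F(\xi)=\frac{1}{2\sqrt{\pi}}\int_{-\infty}^{\xi}e^{-s^2/4}\,ds$, with $F(-\infty)=0$, $F(+\infty)=1$. An increasing self-similar solution is a solution $u(t,x)=v(\xi)$, $\xi=x/\sqrt t$, for which there are numbers $-\infty=\xi_0<\xi_1<\cdots<\xi_n<\xi_{n+1}=+\infty$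 such that the phase transition lines are $x_i(t)=\xi_i\sqrt t$, $v$ is continuous with $v(\xi_i)=u_i$ for $1\le i\le n$, and $$v(\xi)=u_i+\frac{u_{i+1}-u_i}{F(\xi_{i+1}/a_i)-F(\xi_i/a_i)}\left(F(\xi/a_i)-F(\xi_i/a_i)\right),\quad \xi_i<\xi<\xi_{i+1},\ i=0,\ldots,n.$$ *)

(* Defs.v *)
From HB Require Import structures.
From mathcomp Require Import all_boot all_order all_algebra.
From mathcomp Require Import all_classical all_reals all_analysis.

Set Implicit Arguments.
Unset Strict Implicit.
Unset Printing Implicit Defensive.
Import Order.TTheory GRing.Theory Num.Theory.
Import numFieldNormedType.Exports.
Local Open Scope classical_set_scope.
Local Open Scope ring_scope.

(* The families u_0..u_{n+1}, a_0..a_n, k_0..k_n, d_1..d_n, xi_0..xi_{n+1} and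
   x_1..x_n are functions on nat carrying the customary indices; only the values
   at the indices listed here are ever used. *)

Section Stefan.
Variable R : realType.
Implicit Types (n : nat) (u a k d : nat -> R).

(* F is defined on the extended line by integrating over the reals s <= z, so
   that F -oo and F +oo are the integrals over the empty set and over R. *)
Definition F (z : \bar R) : R :=
  (2 * Num.sqrt pi)^-1 *
  \int[lebesgue_measure]_(s in [set s : R | (s%:E <= z)%E])
     expR (- (s ^+ 2 / 4)).

Definition kappa a k (i : nat) : R := k i / a i ^+ 2.

Definition is_right_derivative (f : R -> R) (x l : R) : Prop :=
  h^-1 * (f (x + h) - f x) @[h --> 0^'+] --> l.

Definition is_left_derivative (f : R -> R) (x l : R) : Prop :=
  h^-1 * (f (x + h) - f x) @[h --> 0^'-] --> l.

Definition heat_equation_at (c : R) (w : R -> R -> R) (t y : R) : Prop :=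
  [/\ derivable (fun s => w s y) t 1,
      \forall z \near y, derivable (w t) z 1,
      derivable (derive1 (w t)) y 1 &
      derive1 (fun s => w s y) t = c * derive1n 2 (w t) y].

Definition stefan_condition_at (di ki ki1 : R) (w : R -> R -> R)
    (xi : R -> R) (t : R) : Prop :=
  derivable xi t 1 /\
  exists p q : R,
    [/\ is_right_derivative (w t) (xi t) p,
        is_left_derivative (w t) (xi t) q &
        di * derive1 xi t + ki * p - ki1 * q = 0].

(* w t y is the temperature at time t and position y; only t > 0 matters.
   x i is the i-th phase transition line. *)
Definition stefan_solution n u a k d
    (w : R -> R -> R) (x : nat -> R -> R) : Prop :=
  [/\ forall i, (1 <= i <= n)%N -> forall t : R, 0 < t -> w t (x i t) = u i,
      forall i, (i <= n)%N -> forall t y : R, 0 < t ->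
        u i < w t y < u i.+1 -> heat_equation_at (a i ^+ 2) w t y,
      forall i, (1 <= i <= n)%N -> forall t : R, 0 < t ->
        stefan_condition_at (d i) (k i) (k i.-1) w (x i) t,
      forall y : R, y < 0 -> w t y @[t --> 0^'+] --> u 0%N &
      forall y : R, 0 < y -> w t y @[t --> 0^'+] --> u n.+1].

Definition self_similar_profile n u a (xi : nat -> \bar R) (v : R -> R) : Prop :=
  [/\ continuous v,
      forall i, (1 <= i <= n)%N -> v (fine (xi i)) = u i &
      forall i, (i <= n)%N -> forall z : R, (xi i < z%:E < xi i.+1)%E ->
        v z = u i + (u i.+1 - u i)
                    / (F (xi i.+1 * (a i)^-1%:E) - F (xi i * (a i)^-1%:E))
                    * (F (z / a i)%:E - F (xi i * (a i)^-1%:E))].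

Definition increasing_self_similar_solution n u a k d
    (w : R -> R -> R) (x : nat -> R -> R) : Prop :=
  stefan_solution n u a k d w x /\
  exists (xi : nat -> \bar R) (v : R -> R),
    [/\ [/\ xi 0%N = -oo%E, xi n.+1 = +oo%E &
            forall i, (i <= n)%N -> (xi i < xi i.+1)%E],
        self_similar_profile n u a xi v,
        forall i, (1 <= i <= n)%N -> forall t : R, 0 < t ->
          x i t = fine (xi i) * Num.sqrt t &
        forall t y : R, 0 < t -> w t y = v (y / Num.sqrt t)].

End Stefan.

(* Main.v *)
From HB Require Import structures.
Require Import Defs.
From mathcomp Require Import all_boot all_order all_algebra.
From mathcomp Require Import all_classical all_reals all_analysis.
From mathcomp Require Import ring lra.
Import Order.TTheory GRing.Theory Num.Theory.
Import numFieldNormedType.Exports.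
Local Open Scope classical_set_scope.
Local Open Scope ring_scope.

Set Implicit Arguments.
Unset Strict Implicit.
Unset Printing Implicit Defensive.

(** Write phi for the derivative of F. On the i-th phase the profile is
    prescribed up to the position of its two ends, and it satisfies the heat
    equation and the initial condition whatever these positions are. Only the Stefan conditions remain.
    Multiplied by sqrt t, the condition at xi_i becomes the scalar equation
      d_i xi_i / 2 + R_i(xi_i, xi_(i+1)) - L_i(xi_i, xi_(i-1)) = 0,
    where, with F_j(xi) = F(xi / a_j) and m_j = k_j (u_(j+1) - u_j),
      R_i(x, z) = (m_i / a_i) phi(x / a_i) / (F_i(z) - F_i(x)),
      L_i(x, y) = (m_j / a_j) phi(x / a_j) / (F_j(x) - F_j(y)),   j = i - 1
    ([stefan_condition_balanced]). The theorem thus amounts to existence and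
    uniqueness for this system of n equations in xi_1 < ... < xi_n.

    The left-hand side decreases in xi_(i-1) and in xi_(i+1), and it strictly
    increases when the three points are translated to the right by the same
    amount h. Indeed R_i increases and L_i decreases under such a translation
    ([flux_shift_lt]), because the mean of s over an interval for the density
    phi lies strictly inside the interval. Moreover the term belonging to the
    side that points away from the origin gains at least m_j h / (4 a_j ^ 2)
    ([flux_shift_ge]), where m_j / a_j ^ 2 = kappa_j (u_(j+1) - u_j), and this
    is exactly what the hypothesis needs to absorb the possibly negative
    d_i h / 2 ([balance_shift]).

    The unknowns are then eliminated one after the other. Suppose that the first
    j equations determine xi_j = T(xi_(j+1)), with T(x) < x and
    T(x + h) <= T(x) + h. Substituted in the next equation, T leaves one
    equation in x = xi_(j+1) and z = xi_(j+2) whose left-hand side is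
    continuous and strictly increasing in x, is negative for x near -oo and
    positive for x near z. Hence it has exactly one root x < z, and by the same
    translation argument this root depends on z in the same way as T(x)
    on x ([next_admissible]). Taking z = +oo for the last equation gives the
    unique solution of the system ([full_chain_exists_unique]).

    For existence, the pieces are glued into a continuous nondecreasing
    profile ([profile]); as it is nondecreasing, the temperature determines
    the phase. *)

(** * Derivatives and monotonicity; the Gaussian distribution function *)

Section Gauss.
Context {R : realType}.
Implicit Types (x y z s h a b : R).

Lemma is_derive_pos_lt (f df : R -> R) a b :
  (forall x, is_derive x 1 f (df x)) ->
  (forall x, a < x < b -> 0 < df x) -> a < b -> f a < f b.
Proof.
move=> fd df0 ab.
have fc : {within `[a, b], continuous f}.
  apply: continuous_subspaceT => x.
  by apply/differentiable_continuous/derivable1_diffP; have [] := fd x.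
have [c cab fab] := MVT ab (fun x _ => fd x) fc.
by rewrite -subr_gt0 fab mulr_gt0 ?subr_gt0// df0// (itvP cab).
Qed.

Lemma is_derive_ge_le (f df : R -> R) (k : R) a b :
  (forall x, a <= x <= b -> is_derive x 1 f (df x)) ->
  (forall x, a < x < b -> k <= df x) -> a <= b -> f a + k * (b - a) <= f b.
Proof.
rewrite le_eqVlt => fd df0 /orP[/eqP <-|ab]; first by rewrite subrr mulr0 addr0.
have fc : {within `[a, b], continuous f}.
  apply: derivable_within_continuous => x; rewrite in_itv/= => /fd xd.
  by have [] := xd.
have fd' x : x \in `]a, b[ -> is_derive x 1 f (df x).
  by rewrite in_itv/= => /andP[ax xb]; apply: fd; rewrite !ltW.
have [c cab fab] := MVT ab fd' fc.
rewrite addrC -lerBrDr fab ler_wpM2r ?subr_ge0 ?(ltW ab)//.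
by rewrite df0// (itvP cab).
Qed.

Definition phi (s : R) : R := (2 * Num.sqrt pi)^-1 * expR (- (s ^+ 2 / 4)).

Lemma phi_gt0 s : 0 < phi s.
Proof. by rewrite mulr_gt0 ?expR_gt0// invr_gt0 mulr_gt0// sqrtr_gt0 pi_gt0. Qed.

Lemma phiN s : phi (- s) = phi s.
Proof. by rewrite /phi sqrrN. Qed.

Lemma is_derive_phi s : is_derive s 1 phi (- (s / 2) * phi s).
Proof.
rewrite /phi.
have h : is_derive s 1 (fun x : R => - (x ^+ 2 / 4)) (- (s / 2)).
  apply: (is_derive_eq (f := fun x : R => - (x ^+ 2 / 4))).
  by rewrite /GRing.scale/=; field.
apply: is_derive_eq.
by rewrite /GRing.scale/=; ring.
Qed.

(** With variance 2, the normal density provides the integrability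
    of [phi] and the limits of [F]. *)
Lemma phi_normal s : phi s = normal_pdf 0 (Num.sqrt 2) s.
Proof.
have s2 : Num.sqrt (2 : R) ^+ 2 = 2 by rewrite sqr_sqrtr.
rewrite normal_pdfE ?gt_eqF ?sqrtr_gt0// /normal_peak /normal_fun s2 subr0.
rewrite /phi; congr (_^-1 * expR _); last by rewrite -mulNr; congr (_ / _); ring.
rewrite (_ : 2 * pi *+ 2 = 2 ^+ 2 * pi :> R); last by ring.
by rewrite sqrtrM ?sqr_ge0// sqrtr_sqr ger0_norm.
Qed.


Lemma ray_EFin z : [set s : R | (s%:E <= z%:E)%E] = `]-oo, z]%classic.
Proof. by apply/seteqP; split=> s /=; rewrite in_itv/= lee_fin. Qed.

Lemma ray_Ny : [set s : R | (s%:E <= -oo)%E] = set0.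
Proof. by apply/seteqP; split=> s //=; rewrite leeNy_eq. Qed.

Lemma ray_y : [set s : R | (s%:E <= +oo)%E] = setT.
Proof. by apply/seteqP; split=> s //=; rewrite leey. Qed.

Lemma measurable_ray (z : \bar R) :
  measurable ([set s | (s%:E <= z)%E] : set (measurableTypeR R)).
Proof. by case: z => [z||]; rewrite ?ray_EFin ?ray_Ny ?ray_y. Qed.

Lemma F_normal (z : \bar R) :
  (F z)%:E = normal_prob (0 : R) (Num.sqrt 2) [set s : R | (s%:E <= z)%E].
Proof.
have mz := measurable_ray z.
have iN : lebesgue_measure.-integrable [set s : R | (s%:E <= z)%E]
    (fun s => (normal_pdf (0 : R) (Num.sqrt 2) s)%:E).
  by apply: (@integrableS _ _ _ _ setT) => //; exact: integrable_normal_pdf.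
have c0 : (2 * Num.sqrt pi : R)^-1 != 0.
  by rewrite invr_eq0 mulf_eq0 negb_or pnatr_eq0/= gt_eqF// sqrtr_gt0 pi_gt0.
have iE : lebesgue_measure.-integrable [set s : R | (s%:E <= z)%E]
    (EFin \o (fun s => expR (- (s ^+ 2 / 4)) : R)).
  have := integrableZl mz (2 * Num.sqrt pi) iN; apply: eq_integrable => //= s _.
  by rewrite -phi_normal -EFinM mulVKf// -invr_eq0.
rewrite /F /normal_prob -RintegralZl// /Rintegral fineK.
  by apply: eq_integral => s _; rewrite -phi_normal.
by have := integrable_fin_num mz (integrableZl mz (2 * Num.sqrt pi)^-1 iE).
Qed.

Lemma F_Ny : F (-oo%E : \bar R) = 0 :> R.
Proof. by apply/EFin_inj; rewrite F_normal ray_Ny measure0. Qed.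

Lemma is_derive_F z : is_derive z 1 (fun x => F x%:E) (phi z).
Proof.
have fE : (fun x => F x%:E) = (fun x => \int[lebesgue_measure]_(t in `]-oo, x]) phi t).
  apply/funext => x; apply/EFin_inj; rewrite F_normal ray_EFin /normal_prob.
  rewrite /Rintegral fineK; first by apply: eq_integral => s _; rewrite -phi_normal.
  under eq_integral do rewrite phi_normal.
  apply: integrable_fin_num => //.
  by apply: (@integrableS _ _ _ _ setT) => //; exact: integrable_normal_pdf.
rewrite fE.
suff [dF <-] : derivable (fun x : R => \int[lebesgue_measure]_(t in `]-oo, x]) phi t) z 1 /\
    derive1 (fun x : R => \int[lebesgue_measure]_(t in `]-oo, x]) phi t) z = phi z.
  by rewrite derive1E; exact: derivableP.
apply: (@continuous_FTC1 R phi -oo%O z (z + 1)).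
- by rewrite ltrDl.
- rewrite (_ : EFin \o phi = fun s => (normal_pdf 0 (Num.sqrt 2) s)%:E); last first.
    by apply/funext => s /=; rewrite phi_normal.
  by apply: (@integrableS _ _ _ _ setT) => //; exact: integrable_normal_pdf.
- by rewrite ltNyr.
- apply/differentiable_continuous/derivable1_diffP.
  by have [] := is_derive_phi z.
Qed.

(** As a random variable under the normal law, the identity has distribution
    function [F]. *)
Let idR : measurableTypeR R -> R := idfun.

#[local] HB.instance Definition _ :=
  @isMeasurableFun.Build _ _ _ _ idR (@measurable_id _ _ setT).

Let F_cdf z :
  cdf (idR : {RV normal_prob (0 : R) (Num.sqrt 2) >-> R}) z = (F z%:E)%:E.
Proof. by rewrite F_normal ray_EFin. Qed.

Let fine_cdf :
  fine \o cdf (idR : {RV normal_prob (0 : R) (Num.sqrt 2) >-> R}) = fun x => F x%:E.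
Proof. by apply/funext => x; rewrite -[RHS]/(fine (F x%:E)%:E) -F_cdf. Qed.

Lemma cvg_F_Ny : F x%:E @[x --> -oo] --> F (-oo : \bar R)%E.
Proof. by rewrite F_Ny -fine_cdf; exact/fine_cvg/cvg_cdfNy0. Qed.

Lemma cvg_F_y : F x%:E @[x --> +oo] --> F (+oo : \bar R)%E.
Proof.
have -> : F (+oo : \bar R)%E = 1 :> R.
  by apply/EFin_inj; rewrite F_normal ray_y probability_setT.
by rewrite -fine_cdf; exact/fine_cvg/cvg_cdfy1.
Qed.

End Gauss.

(** * The flux through an end of a phase interval *)

Section Flux.
Context {R : realType}.
Implicit Types (x y s h a b : R) (z : \bar R).

Lemma cvg_pinfty_ge (f : R -> R) l k m :
  f x @[x --> +oo] --> l -> (forall x, m < x -> k <= f x) -> k <= l.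
Proof.
move=> fl kf; rewrite -(cvg_lim (@Rhausdorff R) fl)//.
apply: limr_ge; first by apply/cvg_ex; exists l.
by near=> x; apply: kf; near: x; apply: nbhs_pinfty_gt; exact: num_real.
Unshelve. all: by end_near. Qed.

Lemma F_le (z1 z2 : \bar R) : (z1 <= z2)%E -> F z1 <= F z2.
Proof.
move=> z12; rewrite -lee_fin !F_normal; apply: le_measure.
- by apply/mem_set; exact: measurable_ray.
- by apply/mem_set; exact: measurable_ray.
- by move=> s /= /le_trans; exact.
Qed.

Lemma F_lt_fin x y : x < y -> F x%:E < F y%:E.
Proof.
move=> xy; apply: (is_derive_pos_lt (f := fun x => F x%:E)) xy => s.
  exact: is_derive_F.
by move=> _; exact: phi_gt0.
Qed.

Lemma F_lt (z1 z2 : \bar R) : (z1 < z2)%E -> F z1 < F z2.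
Proof.
move: z1 z2 => [x||] [y||]//=; rewrite ?ltxx//.
- by rewrite lte_fin; exact: F_lt_fin.
- by move=> _; apply: (@lt_le_trans _ _ (F (x + 1)%:E));
    rewrite ?F_lt_fin ?ltrDl// F_le// leey.
- by move=> _; apply: (@le_lt_trans _ _ (F (y - 1)%:E));
    rewrite ?F_lt_fin ?F_le ?leNye// ltrBlDr ltrDl.
- by move=> _; apply: (@le_lt_trans _ _ (F 0%:E)); rewrite ?F_le ?leNye//;
   apply: (@lt_le_trans _ _ (F (0 + 1)%:E));
    rewrite ?F_lt_fin ?ltrDl// F_le// leey.
Qed.

Lemma cvg_phi_y : phi x @[x --> +oo] --> (0 : R).
Proof.
have -> : phi = fun x : R => (2 * Num.sqrt pi)^-1 * gauss_fun (2^-1 * x).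
  apply/funext => x; rewrite /phi /gauss_fun; congr (_ * expR _); by field.
have g0 : gauss_fun (2^-1 * x : R) @[x --> +oo] --> (0 : R).
  apply: (@cvg_comp _ _ _ (fun x => 2^-1 * x) (@gauss_fun R) _ +oo); last first.
    exact: cvg_gauss_fun.
  by apply: gt0_cvgMry => //; exact: cvg_id.
by have := cvgMl_tmp (a := (2 * Num.sqrt pi)^-1) g0; rewrite mulr0; exact.
Qed.

(** The value 0 is the limit of [phi] at infinity; with it the formula for the
    derivative of [F] along a translation also holds at an end [+oo]. *)
Definition phi_ext (z : \bar R) : R := if z is s%:E then phi s else 0.

(** Divided by [F z - F x], this compares [x / 2] with the mean of [s / 2] over
    the interval from [x] to [z] for the density [phi]. As a function of [z] the
    right-hand side vanishes at [x] and has derivative [phi z * (z - x) / 2]; the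
    case [z = +oo] is a limit. *)
Lemma mean_gap_gt0 x z : (x%:E < z)%E ->
  0 < phi x - phi_ext z - x / 2 * (F z - F x%:E).
Proof.
pose f y := phi x - phi y - x / 2 * (F y%:E - F x%:E).
have fx : f x = 0 by rewrite /f !subrr mulr0 subr0.
have fd y : is_derive y 1 f (phi y * ((y - x) / 2)).
  have := is_derive_phi y; have := is_derive_F y => dF dphi.
  rewrite /f; apply: is_derive_eq; rewrite /GRing.scale/=.
  by ring.
have fI a b : x <= a -> a < b -> f a < f b.
  move=> xa; apply: is_derive_pos_lt fd _ => y /andP[ay _].
  by rewrite mulr_gt0 ?phi_gt0// divr_gt0// subr_gt0 (le_lt_trans xa).
case: z => [y|_|//].
  by rewrite lte_fin => xy; rewrite -/(f y) -fx fI.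
rewrite /phi_ext subr0; apply: (@lt_le_trans _ _ (f (x + 1))).
  by rewrite -fx fI// ltrDl.
apply: (@cvg_pinfty_ge f _ _ (x + 1)) => [|y xy]; last first.
  by rewrite ltW// fI// lerDl.
rewrite -[X in X - _]subr0; apply: cvgB.
  by apply: cvgB; [exact: cvg_cst|exact: cvg_phi_y].
by apply: cvgMl_tmp; apply: cvgB; [exact: cvg_F_y|exact: cvg_cst].
Qed.

Lemma phi_le x y : 0 <= x -> x <= y -> phi y <= phi x.
Proof.
move=> x0 xy; rewrite ler_wpM2l ?invr_ge0 ?mulr_ge0 ?sqrtr_ge0// ler_expR.
by rewrite lerN2 ler_wpM2r// ler_sqr ?nnegrE// (le_trans x0).
Qed.

Lemma F_sub_le x y : 0 <= x -> x <= y -> F y%:E - F x%:E <= phi x * (y - x).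
Proof.
move=> x0 xy.
have fd s : is_derive s 1 (fun s => phi x * s - F s%:E) (phi x - phi s).
  have dF := is_derive_F s; apply: is_derive_eq; rewrite /GRing.scale/=.
  by ring.
have := is_derive_ge_le (fun s _ => fd s) (k := 0) _ xy.
rewrite mul0r addr0 => h; suff: phi x * x - F x%:E <= phi x * y - F y%:E by lra.
by apply: h => s /andP[xs _]; rewrite subr_ge0 phi_le// ltW.
Qed.

(** The difference of the two sides vanishes at [z = x], and its derivative in
    [z] is half the product of [phi z] and [phi x * (z - x) - (F z - F x)], which
    is nonnegative because [phi] decreases on the right of the origin. *)
Lemma mean_gap_ge x z : 0 <= x -> (x%:E < z)%E ->
  (F z - F x%:E) ^+ 2 / 4 <= phi x * (phi x - phi_ext z - x / 2 * (F z - F x%:E)).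
Proof.
move=> x0.
pose f y := phi x * (phi x - phi y - x / 2 * (F y%:E - F x%:E))
            - (F y%:E - F x%:E) ^+ 2 / 4.
have fx : f x = 0 by rewrite /f !subrr expr0n /= !(mulr0, mul0r, subr0).
have fd y : is_derive y 1 f
    (phi y * (phi x * (y - x) - (F y%:E - F x%:E)) / 2).
  have dphi := is_derive_phi y; have dF := is_derive_F y.
  rewrite /f; apply: is_derive_eq; rewrite /GRing.scale/=.
  by field.
have fI y : x <= y -> 0 <= f y.
  move=> xy; have := is_derive_ge_le (fun s _ => fd s) (k := 0) _ xy.
  rewrite fx mul0r addr0; apply=> s /andP[xs _].
  by rewrite divr_ge0// mulr_ge0 ?(ltW (phi_gt0 _))// subr_ge0 F_sub_le// ltW.
rewrite -subr_ge0; case: z => [y|_|//].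
  by rewrite lte_fin => xy; rewrite -/(f y) fI// ltW.
rewrite /phi_ext; apply: (@cvg_pinfty_ge f _ _ x) => [|y xy]; last first.
  by rewrite fI// ltW.
have cD : F x0%:E - F x%:E @[x0 --> +oo] --> F +oo%E - F x%:E.
  by apply: cvgB; [exact: cvg_F_y|exact: cvg_cst].
apply: cvgB; last first.
  by apply: cvgMr_tmp; under eq_cvg do rewrite expr2; rewrite expr2; exact: cvgM.
apply: cvgMl_tmp; apply: cvgB; last exact: cvgMl_tmp.
by apply: cvgB; [exact: cvg_cst|exact: cvg_phi_y].
Qed.

(** In a phase that occupies the interval from [x] to [z], with unit diffusivity
    and unit rise of temperature, the slope of the profile at [x]. *)
Definition flux x z := phi x / (F z - F x%:E).

Lemma flux_le x (z1 z2 : \bar R) : (x%:E < z1)%E -> (z1 <= z2)%E ->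
  flux x z2 <= flux x z1.
Proof.
move=> xz z12; have xz2 := lt_le_trans xz z12.
rewrite /flux ler_pM2l ?phi_gt0// lef_pV2 ?posrE ?subr_gt0 ?F_lt//.
by rewrite lerD2r F_le.
Qed.

Lemma flux_ge x z : (x%:E < z)%E -> x / 2 <= flux x z.
Proof.
move=> xz; rewrite ler_pdivlMr ?subr_gt0 ?F_lt//.
have := mean_gap_gt0 xz; have : 0 <= phi_ext z by case: z {xz} => //= s; rewrite ltW ?phi_gt0.
by lra.
Qed.

Lemma is_derive_Fshift z h : z != -oo%E ->
  is_derive h 1 (fun h => F (z + h%:E)) (phi_ext (z + h%:E)).
Proof.
case: z => [y||//] _ /=; last first.
  rewrite (_ : (fun _ => _) = cst (F (+oo : \bar R)%E)); last first.
    by apply/funext => s; rewrite addye.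
  exact: is_derive_cst.
have d1 : is_derive h 1 (fun s => y + s) 1.
  by apply: is_derive_eq; rewrite ?mulr1 add0r.
by have := is_derive1_comp (is_derive_F (y + h)) d1; rewrite mulr1.
Qed.

Lemma is_derive_flux x z h : (x%:E < z)%E ->
  is_derive h 1 (fun h => flux (x + h) (z + h%:E))
    (phi (x + h) * (phi (x + h) - phi_ext (z + h%:E)
      - (x + h) / 2 * (F (z + h%:E) - F (x + h)%:E))
     / (F (z + h%:E) - F (x + h)%:E) ^+ 2).
Proof.
move=> xz; have zN : z != -oo%E by case: z xz.
have D0 s : F (z + s%:E) - F (x + s)%:E != 0.
  by rewrite gt_eqF// subr_gt0 F_lt// EFinD lteD2rE.
have dz := is_derive_Fshift h zN.
have dx : is_derive h 1 (fun s => F (x + s)%:E) (phi (x + h)).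
  exact: (@is_derive_Fshift x%:E h).
have dD : is_derive h 1 (fun s => F (z + s%:E) - F (x + s)%:E)
   (phi_ext (z + h%:E) - phi (x + h)) by exact: is_deriveB.
have dV := @is_deriveV _ (fun s => F (z + s%:E) - F (x + s)%:E) _ _ _ (D0 h) dD.
have dp : is_derive h 1 (fun s => phi (x + s)) (- ((x + h) / 2) * phi (x + h)).
  have d1 : is_derive h 1 (fun s => x + s) 1.
    by apply: is_derive_eq; rewrite ?mulr1 add0r.
  by have := is_derive1_comp (is_derive_phi (x + h)) d1; rewrite mulr1.
rewrite /flux; apply: is_derive_eq; rewrite /GRing.scale/=.
by field; exact: D0.
Qed.

(** A phase translated to the right, at equal length, is steeper at its left
    end: the sign of the derivative is that of [mean_gap_gt0]. *)
Lemma flux_shift_lt x z h : (x%:E < z)%E -> 0 < h ->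
  flux x z < flux (x + h) (z + h%:E).
Proof.
move=> xz h0; have := is_derive_pos_lt (fun s => @is_derive_flux x z s xz) _ h0.
rewrite addr0 adde0; apply => s _.
have sz : ((x + s)%:E < z + s%:E)%E by rewrite EFinD lteD2rE.
by rewrite divr_gt0 ?exprn_gt0 ?subr_gt0 ?F_lt// mulr_gt0 ?phi_gt0 ?mean_gap_gt0.
Qed.

(** When the phase lies on the right of the origin, the gain in steepness is
    uniform, by [mean_gap_ge]. The rate 1/4 is the one that compensates a
    negative [d] in [balance_shift]. *)
Lemma flux_shift_ge x z h : 0 <= x -> (x%:E < z)%E -> 0 <= h ->
  flux x z + h / 4 <= flux (x + h) (z + h%:E).
Proof.
move=> x0 xz h0.
have := is_derive_ge_le (fun s _ => @is_derive_flux x z s xz) (k := 4^-1) _ h0.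
rewrite addr0 adde0 subr0 mulrC; apply => s /andP[s0 _].
have sz : ((x + s)%:E < z + s%:E)%E by rewrite EFinD lteD2rE.
rewrite ler_pdivlMr ?exprn_gt0 ?subr_gt0 ?F_lt// mulrC mean_gap_ge//.
by rewrite addr_ge0// ltW.
Qed.

(** The sum has derivative 0 because [phi] is even; its value is read off at
    infinity. *)
Lemma F_opp z : F z + F (- z)%E = F (+oo : \bar R)%E + F (-oo : \bar R)%E.
Proof.
case: z => [x||]; [|exact: erefl|exact: addrC].
rewrite -[(- _)%E]/(- x)%:E.
pose f x := F x%:E + F (- x)%:E.
have fd s : is_derive s 1 f 0.
  have dF := is_derive_F s.
  have dF' : is_derive s 1 (fun s => F (- s)%:E) (- phi s).
    have d1 : is_derive s 1 (fun s => - s) (- 1) by apply: is_derive_eq.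
    by have := is_derive1_comp (is_derive_F (- s)) d1; rewrite phiN mulrN1.
  by rewrite /f; apply: is_derive_eq; rewrite subrr.
have fc y : f y = f x by apply: is_derive_0_is_cst.
have cf : f y @[y --> +oo] --> F (+oo : \bar R)%E + F (-oo : \bar R)%E.
  apply: cvgD; first exact: cvg_F_y.
  by have := @cvg_F_Ny R; rewrite (cvgNy_compNP (fun y : R => F y%:E)).
apply: (@cvg_unique _ (@Rhausdorff R) _ _ _ _ _ cf).
rewrite (_ : f = cst (f x)); first exact: cvg_cst.
by apply/funext => y; rewrite fc.
Qed.

(** Reflection exchanges the two ends of a phase, so that every estimate at a
    left end gives one at a right end. *)
Lemma flux_opp x z : flux (- x) (- z)%E = phi x / (F x%:E - F z).
Proof.
rewrite /flux phiN; congr (_ / _).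
have := F_opp x%:E; rewrite -(F_opp z) /= => h.
by rewrite EFinN; lra.
Qed.
End Flux.

(** * Adding one more phase *)

Section WFlux.
Context {R : realType}.
Implicit Types (x y s h a b m : R) (z : \bar R).

(** With [m = k * (u2 - u1)], the flux [k * u_x] at time 1 on the right of a
    boundary at [x], when the phase there has diffusivity [a ^+ 2], ends at [z]
    and runs from temperature [u1] to [u2]. In [left_flux] the phase lies on the
    left of [x]. *)
Definition right_flux m a x z := m / a * flux (x / a) (z * a^-1%:E)%E.

Definition left_flux m a x z :=
  m / a * (phi (x / a) / (F (x / a)%:E - F (z * a^-1%:E)%E)).

Lemma left_flux_opp m a x z : left_flux m a x z = right_flux m a (- x) (- z)%E.
Proof. by rewrite /right_flux mulNr mulNe flux_opp. Qed.

Section right_flux.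
Variables m a : R.
Hypotheses (m0 : 0 < m) (a0 : 0 < a).

Lemma scale_lt (z1 z2 : \bar R) :
  ((z1 * a^-1%:E < z2 * a^-1%:E)%E) = (z1 < z2)%E.
Proof. by rewrite lte_pmul2r// lte_fin invr_gt0. Qed.

Lemma scale_EFin x : (x%:E * a^-1%:E = (x / a)%:E)%E.
Proof. by []. Qed.

Lemma scale_shift z h : ((z + h%:E) * a^-1%:E = z * a^-1%:E + (h / a)%:E)%E.
Proof.
case: z => [x||]; first by rewrite -EFinD -!EFinM -EFinD mulrDl.
  by rewrite addye// gt0_mulye// lte_fin invr_gt0.
by rewrite addNye// gt0_mulNye// lte_fin invr_gt0.
Qed.

Lemma right_flux_le x (z1 z2 : \bar R) : (x%:E < z1)%E -> (z1 <= z2)%E ->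
  right_flux m a x z2 <= right_flux m a x z1.
Proof.
move=> xz z12; rewrite ler_pM2l ?divr_gt0// flux_le//.
  by rewrite -scale_EFin scale_lt.
by rewrite lee_pmul2r// lte_fin invr_gt0.
Qed.

Lemma right_flux_ge x z : (x%:E < z)%E -> m / a ^+ 2 * x / 2 <= right_flux m a x z.
Proof.
move=> xz; rewrite (_ : _ / 2 = m / a * (x / a / 2)); last by field; rewrite gt_eqF.
by rewrite ler_pM2l ?divr_gt0// flux_ge// -scale_EFin scale_lt.
Qed.

Lemma right_flux_shift_lt x z h : (x%:E < z)%E -> 0 < h ->
  right_flux m a x z < right_flux m a (x + h) (z + h%:E)%E.
Proof.
move=> xz h0; rewrite ltr_pM2l ?divr_gt0// scale_shift mulrDl flux_shift_lt//.
  by rewrite -scale_EFin scale_lt.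
by rewrite divr_gt0.
Qed.

Lemma right_flux_shift_ge x z h : 0 <= x -> (x%:E < z)%E -> 0 <= h ->
  right_flux m a x z + m / a ^+ 2 * h / 4 <= right_flux m a (x + h) (z + h%:E)%E.
Proof.
move=> x0 xz h0; rewrite (_ : _ / 4 = m / a * (h / a / 4)); last by field; rewrite gt_eqF.
rewrite -mulrDr ler_pM2l ?divr_gt0// scale_shift mulrDl flux_shift_ge//.
- by rewrite divr_ge0// ltW.
- by rewrite -scale_EFin scale_lt.
- by rewrite divr_ge0// ltW.
Qed.

Lemma left_flux_le x (z1 z2 : \bar R) : (z2 < x%:E)%E -> (z1 <= z2)%E ->
  left_flux m a x z1 <= left_flux m a x z2.
Proof. by move=> zx z12; rewrite !left_flux_opp right_flux_le ?leeN2// EFinN lteN2. Qed.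

Lemma left_flux_ge x z : (z < x%:E)%E -> - (m / a ^+ 2 * x / 2) <= left_flux m a x z.
Proof.
move=> zx; rewrite left_flux_opp (le_trans _ (right_flux_ge _)) ?EFinN ?lteN2//.
by rewrite mulrN mulNr.
Qed.

Let opp_shift x z h : - x = - (x + h) + h /\ (- z = - (z + h%:E) + h%:E)%E.
Proof. by split; [ring|rewrite fin_num_oppeD// subeK]. Qed.

Lemma left_flux_shift_lt x z h : (z < x%:E)%E -> 0 < h ->
  left_flux m a (x + h) (z + h%:E)%E < left_flux m a x z.
Proof.
move=> zx h0; rewrite !left_flux_opp.
have [-> ->] := opp_shift x z h; rewrite right_flux_shift_lt//.
by rewrite EFinN lteN2 EFinD lteD2rE.
Qed.

Lemma left_flux_shift_ge x z h : x + h <= 0 -> (z < x%:E)%E -> 0 <= h ->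
  left_flux m a (x + h) (z + h%:E)%E + m / a ^+ 2 * h / 4 <= left_flux m a x z.
Proof.
move=> xh zx h0; rewrite !left_flux_opp.
have [-> ->] := opp_shift x z h; rewrite right_flux_shift_ge// ?oppr_ge0//.
by rewrite EFinN lteN2 EFinD lteD2rE.
Qed.

End right_flux.

Lemma continuous_phi : continuous (phi : R -> R).
Proof.
move=> x; apply/differentiable_continuous/derivable1_diffP.
by have [] := is_derive_phi x.
Qed.

Lemma continuous_F : continuous (fun x : R => F x%:E).
Proof.
move=> x; apply/differentiable_continuous/derivable1_diffP.
by have [] := is_derive_F x.
Qed.

(** [T x] stands for the boundary preceding the one at [x]. The second condition
    says that a translation of [x] moves the preceding boundary at most as far;
    the third is continuity of [T], in a form that includes the constant
    [-oo]. *)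
Definition admissible (T : R -> \bar R) :=
  [/\ forall x, (T x < x%:E)%E,
      forall x h, 0 <= h -> (T (x + h)%R <= T x + h%:E)%E &
      forall a, continuous (fun x => F (T x * a^-1%:E)%E)].

Section step.
Variables (d mr ar ml al : R) (T : R -> \bar R).
Hypotheses (mr0 : 0 < mr) (ar0 : 0 < ar) (ml0 : 0 < ml) (al0 : 0 < al).
Hypotheses (dr : 0 <= mr / ar ^+ 2 + 2 * d) (dl : 0 <= ml / al ^+ 2 + 2 * d).
Hypothesis adT : admissible T.

(** The flux balance at a boundary [x] followed by a boundary [z], when the
    boundaries before [x] have been eliminated by means of [T]. *)
Definition balance x z := d * (x / 2) + right_flux mr ar x z - left_flux ml al x (T x).

Let Tlt x : (T x < x%:E)%E. Proof. by have [] := adT. Qed.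

Let kr0 : 0 < mr / ar ^+ 2. Proof. by rewrite divr_gt0// exprn_gt0. Qed.
Let kl0 : 0 < ml / al ^+ 2. Proof. by rewrite divr_gt0// exprn_gt0. Qed.

Lemma fluxlT_shift x h : 0 <= h ->
  left_flux ml al (x + h) (T (x + h)) <= left_flux ml al (x + h) (T x + h%:E)%E.
Proof.
have [_ Tsh _] := adT => h0; apply: left_flux_le => //; last exact: Tsh.
by rewrite EFinD lteD2rE.
Qed.

(** On the right of the origin the right flux gains at least [kappa h / 4], on
    the left of it the left flux loses at least as much, and in either case this
    dominates the change [d h / 2] of the first term; the other flux contributes
    strictly. An interval containing the origin is split there. *)
Lemma balance_shift x z h : (x%:E < z)%E -> 0 < h ->
  balance x z < balance (x + h) (z + h%:E)%E.
Proof.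
have neg y w s : y + s <= 0 -> (y%:E < w)%E -> 0 < s ->
    balance y w < balance (y + s) (w + s%:E)%E.
  move=> ys yw s0; have := right_flux_shift_lt mr0 ar0 yw s0.
  have := left_flux_shift_ge ml0 al0 ys (Tlt y) (ltW s0).
  have := fluxlT_shift y (ltW s0).
  have : 0 <= (ml / al ^+ 2 + 2 * d) * s by rewrite mulr_ge0// ltW.
  by rewrite /balance; lra.
have pos y w s : 0 <= y -> (y%:E < w)%E -> 0 < s ->
    balance y w < balance (y + s) (w + s%:E)%E.
  move=> y0 yw s0; have := right_flux_shift_ge mr0 ar0 y0 yw (ltW s0).
  have := left_flux_shift_lt ml0 al0 (Tlt y) s0.
  have := fluxlT_shift y (ltW s0).
  have : 0 <= (mr / ar ^+ 2 + 2 * d) * s by rewrite mulr_ge0// ltW.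
  by rewrite /balance; lra.
move=> xz h0; have [x0|x0] := leP 0 x; first exact: pos.
have [xh|xh] := leP (x + h) 0; first exact: neg.
apply: (@lt_trans _ _ (balance (x + - x) (z + (- x)%:E)%E)).
  by apply: neg; rewrite ?subrr// oppr_gt0.
have -> : x + h = x + - x + (x + h) by ring.
have -> : (z + h%:E = z + (- x)%:E + (x + h)%:E)%E.
  by rewrite -addeA -EFinD; congr (_ + _%:E)%E; ring.
by apply: pos; rewrite ?subrr// -(subrr x) EFinD lteD2rE.
Qed.

(** From the translated configuration, bringing [z] back to its place only
    increases the right flux. *)
Lemma balance_lt x y z : x < y -> (y%:E < z)%E -> balance x z < balance y z.
Proof.
move=> xy yz; have yx0 : 0 < y - x by rewrite subr_gt0.
have xz : (x%:E < z)%E by rewrite (lt_trans _ yz)// lte_fin.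
apply: lt_le_trans (balance_shift xz yx0) _.
rewrite addrC subrK lerD2r lerD2l right_flux_le// leeDl// lee_fin ltW//.
Qed.

Lemma balance_le x y z : (x%:E < z)%E -> balance x z <= balance y z -> x <= y.
Proof.
move=> xz; have [//|yx] := leP x y.
by rewrite leNgt balance_lt.
Qed.

(** As [x] tends to [-oo] the right flux stays bounded and the left flux is at
    least [- kappa x / 2], while [d + kappa > 0]. *)
Lemma balance_neg z : (-oo < z)%E -> exists2 x, (x%:E < z)%E & balance x z < 0.
Proof.
move=> z0; have [x0 x0z] : exists x0 : R, (x0%:E < z)%E.
  case: z z0 => [z _||//]; first by exists (z - 1); rewrite lte_fin ltrBlDr ltrDl.
  by exists 0; rewrite ltry.
(* The linear terms add up to x c / 2, which falls below - (|M| + 1) for the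
   following x. *)
pose M := right_flux mr ar x0 z; pose c := d + ml / al ^+ 2.
have c0 : 0 < c by have := kl0; have := kr0; have := dl; have := dr; rewrite /c; lra.
pose x : R := Num.min (x0 - 1) (- (2 * (`|M| + 1) / c)).
have xx0 : x < x0 by rewrite /x gt_min ltrBlDr ltrDl ltr01.
have xc : x * c <= - (2 * (`|M| + 1)).
  by rewrite -ler_pdivlMr// mulNr /x ge_min lexx orbT.
have xz : (x%:E < z)%E by rewrite (lt_trans _ x0z)// lte_fin.
exists x => //.
have Mx : right_flux mr ar x z <= M.
  have h0 : 0 < x0 - x by rewrite subr_gt0.
  have xzh : (x%:E < z - (x0 - x)%:E)%E.
    by rewrite lteBrDr// -EFinD addrC subrK.
  apply: (@le_trans _ _ (right_flux mr ar x (z - (x0 - x)%:E)%E)).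
    by apply: right_flux_le => //; rewrite leeBlDr// leeDl// lee_fin ltW.
  have := right_flux_shift_lt mr0 ar0 xzh h0.
  by rewrite (addrC x) subrK subeK// => /ltW.
have := left_flux_ge ml0 al0 (Tlt x); have := ler_norm M.
by move: xc; rewrite /balance /c; lra.
Qed.

Lemma fluxlT_le x y : x <= y -> left_flux ml al y (T y) <= left_flux ml al x (T x).
Proof.
rewrite le_eqVlt => /orP[/eqP ->//|xy].
have h0 : 0 < y - x by rewrite subr_gt0.
have := fluxlT_shift x (ltW h0); have := left_flux_shift_lt ml0 al0 (Tlt x) h0.
by rewrite addrC subrK; lra.
Qed.

(** For [z = +oo] the right flux grows at least like [kappa x / 2] and the left
    flux is nonincreasing; for a finite [z] the right flux blows up at [z]. *)
Lemma balance_pos z : (-oo < z)%E -> exists2 x, (x%:E < z)%E & 0 < balance x z.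
Proof.
case: z => [z _|_|//]; last first.
  pose C := left_flux ml al 0 (T 0); pose c := d + mr / ar ^+ 2.
  have c0 : 0 < c by have := kl0; have := kr0; have := dl; have := dr; rewrite /c; lra.
  pose x : R := 2 * (`|C| + 1) / c.
  have x0 : 0 <= x by rewrite divr_ge0 ?(ltW c0)// mulr_ge0// addr_ge0.
  have xc : x * c = 2 * (`|C| + 1) by rewrite /x divfK// gt_eqF.
  exists x; first by rewrite ltry.
  have := right_flux_ge mr0 ar0 (ltry x); have := fluxlT_le x0; have := ler_norm C.
  by move: xc; rewrite /balance /c -/C; lra.
pose C := left_flux ml al (z - 1) (T (z - 1)).
(* K is the balance with the left flux frozen at z - 1, multiplied by the
   denominator D of the right flux; it is continuous up to z. *)
pose D x : R := F (z / ar)%:E - F (x / ar)%:E.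
pose K x : R := (d * (x / 2) - C) * D x + mr / ar * phi (x / ar).
have cK : {for z, continuous K}.
  have cz : x / ar @[x --> z] --> z / ar by apply: cvgMr_tmp; exact: cvg_id.
  apply: cvgD; last by apply: cvgMl_tmp; apply: continuous_cvg cz; exact: continuous_phi.
  apply: cvgM.
    by apply: cvgB; [apply: cvgMl_tmp; apply: cvgMr_tmp; exact: cvg_id|exact: cvg_cst].
  apply: cvgB; first exact: cvg_cst.
  by apply: (@cvg_comp _ _ _ _ (fun y : R => F y%:E)) cz _; exact: continuous_F.
have Kz : 0 < K z by rewrite /K /D subrr mulr0 add0r mulr_gt0 ?divr_gt0 ?phi_gt0.
near z^'- => x.
have Kx : 0 < K x.
  by near: x; apply: (cvgr_gt (K z)) => //; exact: cvg_at_left_filter.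
have xz : x < z by near: x; exact: nbhs_left_lt.
have zx : z - 1 < x by near: x; apply: nbhs_left_gt; lra.
exists x; first by rewrite lte_fin.
have D0 : 0 < D x by rewrite /D subr_gt0 F_lt_fin// ltr_pM2r ?invr_gt0.
have := fluxlT_le (ltW zx); rewrite -/C => xC.
have : 0 < K x / D x by rewrite divr_gt0.
rewrite (_ : K x / D x = d * (x / 2) - C + right_flux mr ar x z%:E); last first.
  rewrite /right_flux /flux /K -[F _ - _]/(D x); field.
  by rewrite !gt_eqF.
by rewrite /balance; lra.
Unshelve. all: by end_near. Qed.

Lemma balance_continuous z x : (x%:E < z)%E ->
  {for x, continuous (balance ^~ z)}.
Proof.
move=> xz.
have cx a : x / a @[x --> x] --> x / a by apply: cvgMr_tmp; exact: cvg_id.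
have cF a : F (x / a)%:E @[x --> x] --> F (x / a)%:E.
  by apply: (@cvg_comp _ _ _ _ (fun y : R => F y%:E)) (cx a) _; exact: continuous_F.
have cp a : phi (x / a) @[x --> x] --> phi (x / a).
  by apply: continuous_cvg (cx a); exact: continuous_phi.
apply: cvgB; first apply: cvgD.
- by apply: cvgMl_tmp; exact: cx.
- apply: cvgMl_tmp; apply: cvgM; first exact: cp.
  apply: cvgV; last by apply: cvgB; [exact: cvg_cst|exact: cF].
  by rewrite gt_eqF// subr_gt0 F_lt// -scale_EFin scale_lt.
- apply: cvgMl_tmp; apply: cvgM; first exact: cp.
  apply: cvgV; last by apply: cvgB; [exact: cF|have [_ _] := adT; exact].
  by rewrite gt_eqF// subr_gt0 F_lt// -scale_EFin scale_lt.
Qed.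

Lemma balance_root z : (-oo < z)%E -> exists2 x, (x%:E < z)%E & balance x z = 0.
Proof.
move=> z0; have [x xz xn] := balance_neg z0; have [y yz yp] := balance_pos z0.
have xy : x <= y by apply: (balance_le xz); rewrite ltW// (lt_trans xn).
have cb : {within `[x, y], continuous (balance ^~ z)}.
  apply: continuous_in_subspaceT => s; rewrite inE/= in_itv/= => /andP[_ sy].
  by apply: balance_continuous; rewrite (le_lt_trans _ yz)// lee_fin.
have [|s] := @IVT _ (balance ^~ z) x y 0 xy cb.
  by rewrite ge_min le_max (ltW xn) (ltW yp) orbT.
by rewrite in_itv/= => /andP[_ sy] s0; exists s => //; rewrite (le_lt_trans _ yz)// lee_fin.
Qed.

Lemma balance_root_unique z x y : (x%:E < z)%E -> (y%:E < z)%E ->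
  balance x z = 0 -> balance y z = 0 -> x = y.
Proof.
move=> xz yz x0 y0; apply/eqP; rewrite eq_le.
by rewrite (balance_le xz) ?(balance_le yz) ?x0 ?y0.
Qed.

(** Moving [z] to the right lowers the balance, so the root moves to the right;
    moving [x] and [z] together raises it, so the root moves less than [z]. *)
Lemma next_admissible : exists t : R -> R,
  (forall z : R, t z < z /\ balance (t z) z%:E = 0) /\ admissible (EFin \o t).
Proof.
have ex (z : R) : exists x, x < z /\ balance x z%:E = 0.
  by have [x] := balance_root (ltNyr z); rewrite lte_fin; exists x.
pose t (z : R) := projT1 (cid (ex z)).
have tP (z : R) : t z < z /\ balance (t z) z%:E = 0 by rewrite /t; case: cid.
exists t; split=> //.
have tz (z : R) : ((t z)%:E < z%:E)%E by rewrite lte_fin; case: (tP z).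
have t0 (z : R) : balance (t z) z%:E = 0 by case: (tP z).
have tshift (z : R) h : 0 <= h -> t (z + h) <= t z + h.
  rewrite le_eqVlt => /orP[/eqP <-|h0]; first by rewrite !addr0.
  apply: (@balance_le _ _ (z + h)%:E) => //; rewrite t0 -(t0 z) ltW//.
  by rewrite EFinD balance_shift.
have tmono (z : R) h : 0 <= h -> t z <= t (z + h).
  move=> h0; have zz : (z%:E <= (z + h)%:E)%E by rewrite lee_fin lerDl.
  apply: (@balance_le _ _ (z + h)%:E); first exact: lt_le_trans zz.
  by rewrite t0 -(t0 z) lerD2r lerD2l right_flux_le.
have ct : continuous t.
  have tlip x y : x <= y -> `|t y - t x| <= `|y - x|.
    move=> xy; have h0 : 0 <= y - x by rewrite subr_ge0.
    have := tmono x _ h0; have := tshift x _ h0; rewrite addrC subrK => h1 h2.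
    by rewrite !ger0_norm// ?subr_ge0//; lra.
  move=> x; apply/cvgrPdist_lt => e e0; near=> y.
  apply: (@le_lt_trans _ _ `|x - y|).
    by have [xy|/ltW yx] := leP x y; [rewrite distrC (distrC x)|]; exact: tlip.
  by near: y; exact: cvgr_dist_lt.
split.
- exact: tz.
- by move=> x h h0; rewrite -EFinD lee_fin tshift.
- move=> a x; have cx : t x / a @[x --> x] --> t x / a by apply: cvgMr_tmp; exact: ct.
  by apply: (@cvg_comp _ _ _ _ (fun y : R => F y%:E)) cx _; exact: continuous_F.
Unshelve. all: by end_near. Qed.

End step.
End WFlux.

(** * Chains of free boundaries *)

Section Chain.
Context {R : realType}.
Variables (u a k d : nat -> R).

Definition weight i := k i * (u i.+1 - u i).

(** The Stefan condition at [xi i], freed from its factor [1 / sqrt t]. *)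
Definition flux_balanced (xi : nat -> \bar R) i :=
  d i * (fine (xi i) / 2) + right_flux (weight i) (a i) (fine (xi i)) (xi i.+1)
  - left_flux (weight i.-1) (a i.-1) (fine (xi i)) (xi i.-1) = 0.

Definition chain j (xi : nat -> \bar R) :=
  [/\ xi 0%N = -oo%E, forall i, (i <= j)%N -> (xi i < xi i.+1)%E &
      forall i, (1 <= i <= j)%N -> flux_balanced xi i].

Lemma chain_prev j xi : chain j.+1 xi -> chain j xi.
Proof.
case=> x0 xlt xb; split=> // i; first by move=> ij; exact/xlt/leqW.
by move=> /andP[i1 ij]; apply: xb; rewrite i1 leqW.
Qed.

(** The first [j] conditions determine the first [j] boundaries from the next
    one, and [T] is the resulting dependence of the last of them. *)
Definition solves_prefix j (T : R -> \bar R) :=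
  [/\ admissible T,
      forall x : R, exists xi, [/\ chain j xi, xi j.+1 = x%:E & xi j = T x] &
      forall xi xi', chain j xi -> chain j xi' ->
        forall x : R, xi j.+1 = x%:E -> xi' j.+1 = x%:E ->
        forall i, (i <= j)%N -> xi i = xi' i].

Lemma solves_prefix0 : solves_prefix 0 (fun=> -oo%E).
Proof.
split.
- split=> [x|x h h0|b]; [exact: ltNyr|exact: leNye|exact: cst_continuous].
- move=> x; exists (fun i => if i is 0%N then -oo%E else x%:E); split=> //.
  by split=> // -[|i]//; rewrite ltNyr.
- by move=> xi xi' [x0 _ _] [x0' _ _] x _ _ [|i]//; rewrite x0.
Qed.

Section extend.
Variables (j : nat) (T : R -> \bar R).
Hypothesis ST : solves_prefix j T.

Definition next_balance := balance (d j.+1) (weight j.+1) (a j.+1) (weight j) (a j) T.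

Lemma chain_extend (x : R) z : (x%:E < z)%E -> next_balance x z = 0 ->
  exists xi, [/\ chain j.+1 xi, xi j.+1 = x%:E & xi j.+2 = z].
Proof.
move=> xz b0; have [_ /(_ x)[xi [[x0 xlt xb] xj1 xj]] _] := ST.
pose eta i := if (i <= j.+1)%N then xi i else z.
have etaE i : (i <= j.+1)%N -> eta i = xi i by rewrite /eta => ->.
have etaz : eta j.+2 = z by rewrite /eta ltnn.
exists eta; split; [split|by rewrite etaE|exact: etaz]; first by rewrite etaE.
- move=> i; rewrite leq_eqVlt => /orP[/eqP ->|ij].
    by rewrite etaz etaE// xj1.
  by rewrite !etaE ?xlt// ltnW.
- case=> // i; rewrite /= ltnS leq_eqVlt => /orP[/eqP ->|ij].
    by rewrite /flux_balanced etaz !etaE//= xj1 xj /= -[RHS]b0.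
  by rewrite /flux_balanced/= !etaE// ?xb// leqW// ltnW.
Qed.

(** Uniqueness for the first [j] conditions puts [T x] in the place of [xi j],
    so that the next condition becomes scalar. *)
Lemma chain_last xi : chain j.+1 xi ->
  exists x : R, [/\ xi j.+1 = x%:E, (x%:E < xi j.+2)%E & next_balance x (xi j.+2) = 0].
Proof.
move=> cxi; have [x0 xlt xb] := cxi.
have [x xx] : exists x : R, xi j.+1 = x%:E.
  have := xlt _ (leqnSn j); have := xlt _ (leqnn j.+1).
  by case: (xi j.+1) => [x|/=|]; [exists x|rewrite ltNge leey|move=> _; rewrite ltNge leNye].
exists x; rewrite -xx; split=> //; first exact: xlt.
have [_ /(_ x)[xi' [cxi' xj' Tx]] uniq] := ST.
have := xb j.+1; rewrite ltnS leqnn => /(_ isT); rewrite /flux_balanced xx /= => b0.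
rewrite /next_balance /balance -Tx -(uniq _ _ (chain_prev cxi) cxi' x xx xj' j)//.
Qed.

Hypotheses (m1 : 0 < weight j.+1) (a1 : 0 < a j.+1) (m0 : 0 < weight j) (a0 : 0 < a j).
Hypotheses (dr : 0 <= weight j.+1 / a j.+1 ^+ 2 + 2 * d j.+1)
           (dl : 0 <= weight j / a j ^+ 2 + 2 * d j.+1).

Let adT : admissible T. Proof. by case: ST. Qed.

Lemma chain_exists z : (-oo < z)%E -> exists2 xi, chain j.+1 xi & xi j.+2 = z.
Proof.
move=> z0; have [x xz b0] := balance_root m1 a1 m0 a0 dr dl adT z0.
by have [xi [cxi _ xiz]] := chain_extend xz b0; exists xi.
Qed.

Lemma chain_unique xi xi' : chain j.+1 xi -> chain j.+1 xi' ->
  xi j.+2 = xi' j.+2 -> forall i, (i <= j.+1)%N -> xi i = xi' i.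
Proof.
move=> cx cx' xx i.
have [x [xE xlt xb]] := chain_last cx; have [x' [xE' xlt' xb']] := chain_last cx'.
have {x' xE' xlt' xb'} xj : xi' j.+1 = x%:E.
  rewrite xE'; congr _%:E.
  apply: (balance_root_unique m1 a1 m0 a0 dr dl adT xlt' _ xb'); rewrite -xx//.
rewrite leq_eqVlt => /orP[/eqP ->|]; first by rewrite xE xj.
rewrite ltnS; have [_ _ uniq] := ST.
exact: (uniq _ _ (chain_prev cx) (chain_prev cx') x).
Qed.

Lemma solves_prefixS : exists T', solves_prefix j.+1 T'.
Proof.
have [t [tP adt]] := next_admissible m1 a1 m0 a0 dr dl adT.
exists (EFin \o t); split=> //.
  move=> x; have [tx b0] := tP x.
  have xz : ((t x)%:E < x%:E)%E by rewrite lte_fin.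
  have [xi [cxi xij xiz]] := chain_extend xz b0.
  by exists xi.
move=> xi xi' cx cx' x xx xx'; apply: chain_unique => //.
by rewrite xx xx'.
Qed.

End extend.

Variable n : nat.
Hypotheses (hm : forall i, (i <= n)%N -> 0 < weight i)
           (ha : forall i, (i <= n)%N -> 0 < a i).
Hypothesis hd : forall i, (1 <= i <= n)%N ->
  0 <= weight i / a i ^+ 2 + 2 * d i /\ 0 <= weight i.-1 / a i.-1 ^+ 2 + 2 * d i.

Lemma solves_prefix_ex j : (j < n.+1)%N -> exists T, solves_prefix j T.
Proof.
elim: j => [_|j IHj jn]; first by exists (fun=> -oo%E); exact: solves_prefix0.
have [T ST] := IHj (ltnW jn).
by have [] := hd (i := j.+1) jn; apply: solves_prefixS ST _ _ _ _;
  rewrite ?hm ?ha// ltnW.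
Qed.

(** The induction runs over finite positions of the next boundary; only the last
    condition is solved with that boundary at [+oo]. *)
Lemma full_chain_exists_unique : (1 <= n)%N -> exists xi,
  [/\ chain n xi, xi n.+1 = +oo%E &
      forall xi', chain n xi' -> xi' n.+1 = +oo%E ->
      forall i, (i <= n.+1)%N -> xi' i = xi i].
Proof.
move: hm ha hd solves_prefix_ex; case: n => // j hmj haj hdj sol _.
have [T ST] := sol j (leqnSn _).
have [dr dl] := hdj j.+1 (leqnn _).
have hm1 := hmj _ (leqnn j.+1); have ha1 := haj _ (leqnn j.+1).
have hm0 := hmj _ (leqnSn j); have ha0 := haj _ (leqnSn j).
have [xi cxi xiz] := chain_exists ST hm1 ha1 hm0 ha0 dr dl (z := +oo%E) isT.
exists xi; split=> // xi' cxi' xiz' i; rewrite leq_eqVlt => /orP[/eqP ->|ij].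
  by rewrite xiz.
by apply: (chain_unique ST hm1 ha1 hm0 ha0 dr dl) ij => //; rewrite xiz.
Qed.
End Chain.

(** * The Stefan condition as a flux balance *)

Section OneSided.
Context {R : realType}.
Implicit Types (f g : R -> R) (x l e : R).

Let growth_eq f g x (h : R) : f (x + h) = g (x + h) -> f x = g x ->
  h^-1 *: (g (h *: 1 + x) - g x) = h^-1 * (f (x + h) - f x).
Proof. by move=> fgh fg; rewrite fgh fg /GRing.scale/= mulr1 (addrC h). Qed.

Lemma right_derivative_eq f g x l e : 0 < e -> f x = g x ->
  (forall y, x < y < x + e -> f y = g y) ->
  is_derive x 1 g l -> is_right_derivative f x l.
Proof.
move=> e0 fgx fg gl; have [/cvg_ex[l' gl'] gE] := gl.
have {gE} l'E : l' = l by rewrite -gE; apply/esym/cvg_lim.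
rewrite l'E in gl'; apply: cvg_trans (cvg_dnbhs_at_right gl').
apply: near_eq_cvg; near=> h; apply: growth_eq => //; apply: fg.
rewrite ltrDl ltrD2l; apply/andP; split; near: h.
  exact: nbhs_right_gt.
exact: nbhs_right_lt.
Unshelve. all: by end_near. Qed.

Lemma left_derivative_eq f g x l e : 0 < e -> f x = g x ->
  (forall y, x - e < y < x -> f y = g y) ->
  is_derive x 1 g l -> is_left_derivative f x l.
Proof.
move=> e0 fgx fg gl; have [/cvg_ex[l' gl'] gE] := gl.
have {gE} l'E : l' = l by rewrite -gE; apply/esym/cvg_lim.
rewrite l'E in gl'; apply: cvg_trans (cvg_dnbhs_at_left gl').
apply: near_eq_cvg; near=> h; apply: growth_eq => //; apply: fg.
rewrite gtrDl ltrD2l; apply/andP; split; near: h.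
  by apply: nbhs_left_gt; rewrite oppr_lt0.
exact: nbhs_left_lt.
Unshelve. all: by end_near. Qed.

Lemma right_derivative_unique f x l l' :
  is_right_derivative f x l -> is_right_derivative f x l' -> l = l'.
Proof. by move=> fl fl'; apply: (cvg_unique _ fl fl'). Qed.

Lemma left_derivative_unique f x l l' :
  is_left_derivative f x l -> is_left_derivative f x l' -> l = l'.
Proof. by move=> fl fl'; apply: (cvg_unique _ fl fl'). Qed.

End OneSided.

Section Piece.
Context {R : realType}.
Variables (u a k d : nat -> R) (xi : nat -> \bar R).

Definition slope i := (u i.+1 - u i) /
  (F (xi i.+1 * (a i)^-1%:E)%E - F (xi i * (a i)^-1%:E)%E).

(** The formula of the [i]-th phase makes sense on the whole line, so that
    one-sided derivatives at the ends of the phase are derivatives of [piece]. *)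
Definition piece i (z : R) :=
  u i + slope i * (F (z / a i)%:E - F (xi i * (a i)^-1%:E)%E).

Definition dpiece i (z : R) := slope i * (phi (z / a i) / a i).

Lemma is_derive_divr (z b : R) : is_derive z 1 (fun s : R => s / b) b^-1.
Proof.
rewrite (_ : (fun s => _) = b^-1 \*: id); last first.
  by apply/funext => s; rewrite /GRing.scale /= mulrC.
by apply: is_derive_eq; rewrite /GRing.scale/= mulr1.
Qed.

Lemma is_derive_piece i (z : R) : is_derive z 1 (piece i) (dpiece i z).
Proof.
have dF := @is_derive1_comp _ (fun s => F s%:E) (fun s => s / a i) _ _ _
  (is_derive_F (z / a i)) (is_derive_divr z (a i)).
rewrite /piece; apply: is_derive_eq; rewrite /dpiece /GRing.scale/=.
by rewrite add0r mul1r subr0.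
Qed.

Lemma piece_lo i x : xi i = x%:E -> piece i x = u i.
Proof. by move=> xx; rewrite /piece xx -EFinM subrr mulr0 addr0. Qed.

Lemma piece_hi i x : (xi i < xi i.+1)%E -> 0 < a i -> xi i.+1 = x%:E ->
  piece i x = u i.+1.
Proof.
move=> xlt a0 xx; rewrite /piece /slope xx -EFinM divfK; first by rewrite addrC subrK.
by rewrite gt_eqF// subr_gt0 F_lt// -scale_EFin scale_lt// -xx.
Qed.

Lemma dpiece_fluxr i x : xi i = x%:E ->
  k i * dpiece i x = right_flux (weight u k i) (a i) x (xi i.+1).
Proof.
move=> xx; rewrite /dpiece /slope /right_flux /weight /flux xx -EFinM.
by ring.
Qed.

Lemma dpiece_fluxl i x : xi i.+1 = x%:E ->
  k i * dpiece i x = left_flux (weight u k i) (a i) x (xi i).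
Proof.
move=> xx; rewrite /dpiece /slope /left_flux /weight xx -EFinM.
by ring.
Qed.

End Piece.

Lemma ereal_right_room {R : realType} (x : R) (z : \bar R) : (x%:E < z)%E ->
  exists2 e : R, 0 < e & ((x + e)%:E <= z)%E.
Proof.
case: z => [z||//]; last by exists 1; rewrite ?leey.
by rewrite lte_fin => xz; exists (z - x); rewrite ?subr_gt0// lee_fin addrC subrK.
Qed.

Lemma ereal_left_room {R : realType} (x : R) (z : \bar R) : (z < x%:E)%E ->
  exists2 e : R, 0 < e & (z <= (x - e)%:E)%E.
Proof.
case: z => [z|//|]; last by exists 1; rewrite ?leNye.
by rewrite lte_fin => xz; exists (x - z); rewrite ?subr_gt0// lee_fin opprB addrC subrK.
Qed.

Section Stefan.
Context {R : realType}.
Implicit Types (t s y : R).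
Variables (n : nat) (u a k d : nat -> R) (xi : nat -> \bar R) (v : R -> R).
Variables (w : R -> R -> R) (x : nat -> R -> R).
Hypothesis a0 : forall i, (i <= n)%N -> 0 < a i.
Hypothesis xi_lt : forall i, (i <= n)%N -> (xi i < xi i.+1)%E.
Hypothesis v_node : forall i, (1 <= i <= n)%N -> v (fine (xi i)) = u i.
Hypothesis v_piece : forall i, (i <= n)%N ->
  forall z : R, (xi i < z%:E < xi i.+1)%E -> v z = piece u a xi i z.
Hypothesis x_line : forall i, (1 <= i <= n)%N -> forall t : R, 0 < t ->
  x i t = fine (xi i) * Num.sqrt t.
Hypothesis w_v : forall t y : R, 0 < t -> w t y = v (y / Num.sqrt t).

Lemma xi_fin i : (1 <= i <= n)%N -> exists x : R, xi i = x%:E.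
Proof.
case: i => // i /= ij; have := xi_lt ij; have := xi_lt (ltnW ij).
by case: (xi i.+1) => [s|_|]; [exists s|rewrite ltNge leey|rewrite ltNge leNye].
Qed.

Lemma derive_line i t : (1 <= i <= n)%N -> 0 < t ->
  is_derive t 1 (x i) (fine (xi i) / 2 / Num.sqrt t).
Proof.
move=> ij t0; apply: (@near_eq_is_derive _ _ _ (fun s => fine (xi i) * Num.sqrt s)).
  by near=> s; rewrite x_line//; near: s; exact: lt_nbhsr.
have ds := is_derive1_sqrt t0.
apply: is_derive_eq; rewrite /GRing.scale/= invfM mulrA.
by ring.
Unshelve. all: by end_near. Qed.

Lemma is_derive_piece_scaled i (t y : R) :
  is_derive y 1 (fun y => piece u a xi i (y / Num.sqrt t))
    (dpiece u a xi i (y / Num.sqrt t) / Num.sqrt t).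
Proof.
exact: (@is_derive1_comp _ _ (fun s => s / Num.sqrt t) _ _ _
  (is_derive_piece _ _ _ _ _) (is_derive_divr y (Num.sqrt t))).
Qed.

Lemma stefan_right i t s : (1 <= i <= n)%N -> 0 < t -> xi i = s%:E ->
  is_right_derivative (w t) (x i t) (dpiece u a xi i s / Num.sqrt t).
Proof.
move=> ij t0 xs; have /andP[i1 ile] := ij.
have st0 : 0 < Num.sqrt t by rewrite sqrtr_gt0.
have xE : x i t / Num.sqrt t = s by rewrite x_line// xs /= mulfK// gt_eqF.
have xE' : s * Num.sqrt t = x i t by rewrite x_line// xs.
have [e e0 se] : exists2 e, 0 < e & ((s + e)%:E <= xi i.+1)%E.
  by apply: ereal_right_room; rewrite -xs xi_lt.
have := is_derive_piece_scaled i t (x i t); rewrite xE.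
apply: (right_derivative_eq (e := e * Num.sqrt t)); first by rewrite mulr_gt0.
  by rewrite w_v// xE (piece_lo _ _ xs) -(v_node ij) xs.
move=> y /andP[xy ye]; rewrite w_v//; apply: v_piece => //; rewrite xs lte_fin.
rewrite -xE ltr_pM2r ?invr_gt0// xy/=; apply: lt_le_trans se.
by rewrite lte_fin ltr_pdivrMr// mulrDl xE'.
Qed.

Lemma stefan_left i t s : (1 <= i <= n)%N -> 0 < t -> xi i = s%:E ->
  is_left_derivative (w t) (x i t) (dpiece u a xi i.-1 s / Num.sqrt t).
Proof.
move=> ij t0 xs; have /andP[i1 ile] := ij.
have i1E : i.-1.+1 = i by rewrite prednK.
have i1n : (i.-1 <= n)%N by rewrite (leq_trans (leq_pred i)).
have st0 : 0 < Num.sqrt t by rewrite sqrtr_gt0.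
have xE : x i t / Num.sqrt t = s by rewrite x_line// xs /= mulfK// gt_eqF.
have xE' : s * Num.sqrt t = x i t by rewrite x_line// xs.
have xl : (xi i.-1 < s%:E)%E by rewrite -xs -[in X in (_ < X)%E]i1E xi_lt.
have [e e0 se] : exists2 e, 0 < e & (xi i.-1 <= (s - e)%:E)%E.
  exact: ereal_left_room.
have := is_derive_piece_scaled i.-1 t (x i t); rewrite xE.
apply: (left_derivative_eq (e := e * Num.sqrt t)); first by rewrite mulr_gt0.
  rewrite w_v// xE (@piece_hi _ u a xi i.-1 s); rewrite ?i1E//.
  - by rewrite -(v_node ij) xs.
  - by rewrite xs.
  - exact: a0.
move=> y /andP[ye xy]; rewrite w_v//; apply: v_piece => //; rewrite i1E xs lte_fin.
rewrite -[X in _ < X]xE ltr_pM2r ?invr_gt0// xy andbT; apply: le_lt_trans se _.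
by rewrite lte_fin ltr_pdivlMr// mulrBl xE'.
Qed.

(** At time [t] each term of the Stefan condition is the matching term of the
    flux balance divided by [sqrt t]. *)
Lemma stefan_condition_balanced i t : (1 <= i <= n)%N -> 0 < t ->
  stefan_condition_at (d i) (k i) (k i.-1) w (x i) t <->
  flux_balanced u a k d xi i.
Proof.
move=> ij t0; have [s xs] := xi_fin ij; have /andP[i1 _] := ij.
have i1E : i.-1.+1 = i by rewrite prednK.
have st0 : 0 < Num.sqrt t by rewrite sqrtr_gt0.
have [dx dxE] := derive_line ij t0.
have rd := stefan_right ij t0 xs; have ld := stefan_left ij t0 xs.
have fE : flux_balanced u a k d xi i <->
    d i * (s / 2) + k i * dpiece u a xi i s - k i.-1 * dpiece u a xi i.-1 s = 0.
  rewrite /flux_balanced xs /= (dpiece_fluxr _ _ _ xs) dpiece_fluxl//.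
  by rewrite i1E.
have E : d i * derive1 (x i) t + k i * (dpiece u a xi i s / Num.sqrt t)
       - k i.-1 * (dpiece u a xi i.-1 s / Num.sqrt t) =
    (d i * (s / 2) + k i * dpiece u a xi i s - k i.-1 * dpiece u a xi i.-1 s)
    / Num.sqrt t.
  by rewrite derive1E dxE xs /=; ring.
rewrite fE; split.
  move=> [_ [p [q [/(right_derivative_unique rd) <- /(left_derivative_unique ld) <-]]]].
  by rewrite E => /eqP; rewrite mulf_eq0 invr_eq0 (gt_eqF st0) orbF => /eqP.
move=> e0; split=> //; do 2 eexists; split; [exact: rd|exact: ld|].
by rewrite E e0 mul0r.
Qed.

End Stefan.

(** * The profile attached to a chain of free boundaries *)

Section Existence.
Context {R : realType}.
Implicit Types (t s y z : R).
Variables (n : nat) (u a : nat -> R) (xi : nat -> \bar R).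
Hypothesis a0 : forall i, (i <= n)%N -> 0 < a i.
Hypothesis u_lt : forall i, (i <= n)%N -> u i < u i.+1.
Hypothesis xi_lt : forall i, (i <= n)%N -> (xi i < xi i.+1)%E.
Hypothesis xi0 : xi 0%N = -oo%E.
Hypothesis xin : xi n.+1 = +oo%E.

(** Going down from [xi n.+1 = +oo], the first boundary at or below [z] is
    reached at the latest at [xi 0 = -oo]. *)
Lemma locate z : exists i, [/\ (i <= n)%N, (xi i <= z%:E)%E & (z%:E < xi i.+1)%E].
Proof.
suff loc m : (m <= n)%N -> (z%:E < xi m.+1)%E ->
    exists i, [/\ (i <= n)%N, (xi i <= z%:E)%E & (z%:E < xi i.+1)%E].
  by apply: (loc n) => //; rewrite xin ltry.
elim: m => [_ z1|m IHm mn zm]; first by exists 0%N; rewrite xi0 leNye.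
have [xz|zx] := leP (xi m.+1) z%:E; first by exists m.+1.
exact: IHm (ltnW mn) zx.
Qed.

Lemma xi_le i j : (i <= j)%N -> (j <= n.+1)%N -> (xi i <= xi j)%E.
Proof.
elim: j => [|j IHj]; first by rewrite leqn0 => /eqP ->.
rewrite leq_eqVlt ltnS => /orP[/eqP -> //|ij] jn.
by rewrite (le_trans (IHj ij (ltnW jn)))// ltW// xi_lt.
Qed.

Let A i := F (xi i * (a i)^-1%:E)%E.
Let B i := F (xi i.+1 * (a i)^-1%:E)%E.

Let AB i : (i <= n)%N -> A i < B i.
Proof. by move=> ij; rewrite F_lt// scale_lt ?a0// xi_lt. Qed.

Lemma slope_gt0 i : (i <= n)%N -> 0 < slope u a xi i.
Proof. by move=> ij; rewrite divr_gt0// subr_gt0; [exact: u_lt|exact: AB]. Qed.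

Let G i z := Num.max (A i) (Num.min (F (z / a i)%:E) (B i)).

(** Truncating the pieces instead of defining the profile by cases makes it
    continuous and nondecreasing at once; on the [i]-th phase the earlier terms
    telescope to [u i - u 0] and the later ones vanish. *)
Definition profile z := u 0%N + \sum_(0 <= i < n.+1) slope u a xi i * (G i z - A i).

Lemma profile_piece i z : (i <= n)%N -> (xi i <= z%:E <= xi i.+1)%E ->
  profile z = piece u a xi i z.
Proof.
move=> ij /andP[xz zx].
have scale_le j (z1 z2 : \bar R) : (j <= n)%N -> (z1 <= z2)%E ->
    F (z1 * (a j)^-1%:E)%E <= F (z2 * (a j)^-1%:E)%E.
  by move=> jn z12; rewrite F_le// lee_pmul2r// lte_fin invr_gt0 a0.
have lo : \sum_(0 <= j < i) slope u a xi j * (G j z - A j) = u i - u 0%N.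
  rewrite -telescope_sumr//; apply: eq_big_nat => j /= ji.
  have jn := ltnW (leq_trans ji ij).
  have FB : B j <= F (z / a j)%:E.
    apply: (scale_le j (xi j.+1) z%:E) => //; apply: le_trans xz.
    by apply: xi_le => //; exact: leqW.
  rewrite /G (min_r FB) max_r ?(ltW (AB jn))//.
  by rewrite /slope divfK// gt_eqF// subr_gt0 AB.
have hi : \sum_(i.+1 <= j < n.+1) slope u a xi j * (G j z - A j) = 0.
  rewrite big_nat; apply: big1 => j /andP[ji]; rewrite ltnS => jn.
  have FA : F (z / a j)%:E <= A j.
    apply: (scale_le j z%:E (xi j)) => //; apply: (le_trans zx).
    by apply: xi_le => //; exact: leqW.
  by rewrite /G max_l ?subrr ?mulr0// ge_min FA.
have FA : A i <= F (z / a i)%:E by exact: (scale_le i (xi i) z%:E).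
have FB : F (z / a i)%:E <= B i by exact: (scale_le i z%:E (xi i.+1)).
have mid : G i z = F (z / a i)%:E by rewrite /G (min_l FB) (max_r FA).
rewrite /profile (big_cat_nat (n := i)) ?(leqW ij)//= lo.
by rewrite (@big_ltn _ _ _ i) ?ltnS//= hi mid addr0 addrA addrC subrKC addrC.
Qed.

Lemma profile_node i s : (1 <= i <= n)%N -> xi i = s%:E -> profile s = u i.
Proof.
move=> /andP[i1 ij] xs; rewrite (profile_piece ij) ?(piece_lo _ _ xs)//.
by rewrite -xs lexx/= ltW// xi_lt.
Qed.

Lemma profile_le y z : y <= z -> profile y <= profile z.
Proof.
move=> yz; rewrite lerD2l; apply: ler_sum_nat => i /=; rewrite ltnS => ij.
rewrite ler_wpM2l ?(ltW (slope_gt0 ij))// lerD2r.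
have FF : F (y / a i)%:E <= F (z / a i)%:E.
  by rewrite F_le// lee_fin ler_pM2r// invr_gt0 a0.
by rewrite /G ge_max !le_max lexx/= le_min !ge_min FF lexx !orbT.
Qed.

(** Monotonicity turns bounds on the temperature into bounds on the position. *)
Lemma profile_between i z : (i <= n)%N -> u i < profile z < u i.+1 ->
  (xi i < z%:E < xi i.+1)%E.
Proof.
move=> ij /andP[uv vu]; apply/andP; split.
  rewrite ltNge; apply/negP => zx.
  case: i ij uv vu zx => [|i] ij uv vu zx; first by rewrite xi0 in zx.
  have [s xs] := xi_fin xi_lt (i := i.+1) ij.
  move: zx; rewrite xs lee_fin => /profile_le.
  by rewrite (profile_node (i := i.+1) ij xs) leNgt uv.
rewrite ltNge; apply/negP => xz.
have i1n : (i.+1 <= n)%N.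
  by rewrite ltn_neqAle ij andbT; apply/negP => /eqP iE; move: xz; rewrite iE xin.
have [s xs] := xi_fin xi_lt (i := i.+1) i1n.
move: xz; rewrite xs lee_fin => /profile_le.
by rewrite (profile_node (i := i.+1) i1n xs) leNgt vu.
Qed.

Lemma profile_continuous : continuous profile.
Proof.
move=> z; apply: cvgD; first exact: cvg_cst.
apply: cvg_big => [|i _]; first exact: add_continuous.
apply: cvgMl_tmp; apply: cvgB; last exact: cvg_cst.
apply: (@continuous_max _ _ (cst (A i)) _ z); first exact: cvg_cst.
apply: (@continuous_min _ _ (fun z => F (z / a i)%:E) (cst (B i)) z); last exact: cvg_cst.
have cz : s / a i @[s --> z] --> z / a i by apply: cvgMr_tmp; exact: cvg_id.
by apply: (@cvg_comp _ _ _ _ (fun y : R => F y%:E)) cz _; exact: continuous_F.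
Qed.


Lemma cvg_divr_Ny (b : R) : 0 < b -> z / b @[z --> -oo] --> -oo.
Proof. by move=> b0; apply: gt0_cvgMlNy; rewrite ?invr_gt0//; exact: cvg_id. Qed.

Lemma cvg_divr_y (b : R) : 0 < b -> z / b @[z --> +oo] --> +oo.
Proof. by move=> b0; apply: gt0_cvgMly; rewrite ?invr_gt0//; exact: cvg_id. Qed.

Lemma profile_Ny : profile z @[z --> -oo] --> u 0%N.
Proof.
have [s sx] : exists s, (s%:E <= xi 1%N)%E.
  have := xi_lt (leq0n n); rewrite xi0.
  by case: (xi 1%N) => [s||]//; [exists s|exists 0; rewrite leey].
have nE : \forall z \near -oo, piece u a xi 0 z = profile z.
  near=> z; rewrite (profile_piece (i := 0%N))// xi0 leNye/= (le_trans _ sx)//.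
  by rewrite lee_fin; near: z; apply: nbhs_ninfty_le; exact: num_real.
apply: cvg_trans (near_eq_cvg nE) _.
have -> : u 0%N = u 0%N + slope u a xi 0 * (A 0%N - A 0%N).
  by rewrite subrr mulr0 addr0.
apply: cvgD; first exact: cvg_cst.
apply: cvgMl_tmp; apply: cvgB; last exact: cvg_cst.
rewrite /A xi0 gt0_mulNye ?lte_fin ?invr_gt0 ?a0//.
apply: (@cvg_comp _ _ _ _ (fun y : R => F y%:E)) (cvg_divr_Ny (a0 (leq0n n))) _.
exact: cvg_F_Ny.
Unshelve. all: by end_near. Qed.

Lemma profile_y : profile z @[z --> +oo] --> u n.+1.
Proof.
have [s sx] : exists s, (xi n <= s%:E)%E.
  have := xi_lt (leqnn n); rewrite xin.
  by case: (xi n) => [s||]//; [exists s|exists 0; rewrite leNye].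
have nE : \forall z \near +oo, piece u a xi n z = profile z.
  near=> z; rewrite (profile_piece (i := n))// xin leey andbT (le_trans sx)//.
  by rewrite lee_fin; near: z; apply: nbhs_pinfty_ge; exact: num_real.
apply: cvg_trans (near_eq_cvg nE) _.
have -> : u n.+1 = u n + slope u a xi n * (B n - A n).
  by rewrite /slope divfK ?subrKC// gt_eqF// subr_gt0 AB.
apply: cvgD; first exact: cvg_cst.
apply: cvgMl_tmp; apply: cvgB; last exact: cvg_cst.
rewrite /B xin gt0_mulye ?lte_fin ?invr_gt0 ?a0//.
apply: (@cvg_comp _ _ _ _ (fun y : R => F y%:E)) (cvg_divr_y (a0 (leqnn n))) _.
exact: cvg_F_y.
Unshelve. all: by end_near. Qed.

Lemma cvg_inv_sqrt : (Num.sqrt t)^-1 @[t --> (0:R)^'+] --> +oo.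
Proof.
apply/cvgryPgt => M; near=> t.
have t0 : 0 < t by near: t; exact: nbhs_right_gt.
pose c := `|M| + 1; have c0 : 0 < c by rewrite ltr_wpDl.
apply: (@lt_le_trans _ _ c); first by rewrite (le_lt_trans (ler_norm M))// ltrDl.
rewrite -[c]invrK lef_pV2 ?posrE ?invr_gt0 ?sqrtr_gt0//.
have -> : c^-1 = Num.sqrt (c^-1 ^+ 2).
  by rewrite sqrtr_sqr ger0_norm// invr_ge0 ltW.
rewrite ler_sqrt; last by rewrite sqr_ge0.
near: t; apply: nbhs_right_le; rewrite exprn_gt0// invr_gt0.
by rewrite ltr_wpDl.
Unshelve. all: by end_near. Qed.

Lemma initial_left y : y < 0 -> profile (y / Num.sqrt t) @[t --> 0^'+] --> u 0%N.
Proof.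
move=> y0; apply: cvg_comp profile_Ny.
apply/cvgNry; rewrite (_ : - _ = fun t => - y * (Num.sqrt t)^-1); last first.
  by apply/funext => t; rewrite mulNr.
by apply: gt0_cvgMry; [rewrite oppr_gt0|exact: cvg_inv_sqrt].
Qed.

Lemma initial_right y : 0 < y -> profile (y / Num.sqrt t) @[t --> 0^'+] --> u n.+1.
Proof.
move=> y0; apply: cvg_comp profile_y.
by apply: gt0_cvgMry => //; exact: cvg_inv_sqrt.
Qed.

(** The equation holds because [phi] has derivative [- s / 2 * phi s]. *)
Lemma piece_heat i t y : 0 < t -> (xi i < (y / Num.sqrt t)%:E < xi i.+1)%E ->
  (i <= n)%N -> heat_equation_at (a i ^+ 2) (fun t y => profile (y / Num.sqrt t)) t y.
Proof.
move=> t0 /andP[xy yx] ij; set r := y / Num.sqrt t.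
have st0 : 0 < Num.sqrt t by rewrite sqrtr_gt0.
have ai0 := a0 ij.
have nr : \forall z \near r, piece u a xi i z = profile z.
  have [e e0 re] := ereal_right_room yx; have [e' e'0 re'] := ereal_left_room xy.
  near=> z; rewrite (profile_piece ij)//; apply/andP; split.
    apply: (le_trans re'); rewrite lee_fin ltW//; near: z; apply: lt_nbhsr.
    by rewrite ltrBlDr ltrDl.
  apply: le_trans re; rewrite lee_fin ltW//; near: z; apply: lt_nbhsl.
  by rewrite ltrDl.
have dt : is_derive t 1 (fun s => y / Num.sqrt s)
    (y * (- (Num.sqrt t) ^- 2 * (2 * Num.sqrt t)^-1)).
  have dV := @is_deriveV _ Num.sqrt t _ 1 (lt0r_neq0 st0) (is_derive1_sqrt t0).
  by apply: is_derive_eq; rewrite /GRing.scale/= ?mulr0 ?addr0 ?mulr1.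
have nt : \forall s \near t, piece u a xi i (y / Num.sqrt s) = profile (y / Num.sqrt s).
  have ct : {for t, continuous (fun s => y / Num.sqrt s)}.
    by apply/differentiable_continuous/derivable1_diffP; case: dt.
  exact: ct nr.
have ny : \forall z \near y, piece u a xi i (z / Num.sqrt t) = profile (z / Num.sqrt t).
  have cy : z / Num.sqrt t @[z --> y] --> r by apply: cvgMr_tmp; exact: cvg_id.
  exact: cy nr.
pose D1 z := dpiece u a xi i (z / Num.sqrt t) / Num.sqrt t.
have dw z : (\forall x \near z, piece u a xi i (x / Num.sqrt t) = profile (x / Num.sqrt t)) ->
    is_derive z 1 (fun x => profile (x / Num.sqrt t)) (D1 z).
  by move=> nz; apply: near_eq_is_derive nz _; exact: is_derive_piece_scaled.
have nD : \forall z \near y, D1 z = derive1 (fun x => profile (x / Num.sqrt t)) z.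
  have := near_join ny; apply: filterS => z /dw [_ <-].
  by rewrite derive1E.
have dD1 : is_derive y 1 D1 (slope u a xi i *
   (- (r / a i / 2) * phi (r / a i) / a i / a i) / Num.sqrt t / Num.sqrt t).
  have d1 := @is_derive1_comp _ (@phi R) (fun s => s / a i) r _ _
    (is_derive_phi _) (is_derive_divr r (a i)).
  have d2 : is_derive r 1 (dpiece u a xi i)
      (slope u a xi i * (- (r / a i / 2) * phi (r / a i) / a i / a i)).
    rewrite /dpiece; apply: is_derive_eq; rewrite /GRing.scale/=.
    by ring.
  have d3 := @is_derive1_comp _ _ (fun s => s / Num.sqrt t) _ _ _
    d2 (is_derive_divr y (Num.sqrt t)).
  rewrite /D1; apply: is_derive_eq; rewrite /GRing.scale/=.
  by ring.
have dT : is_derive t 1 (fun s => profile (y / Num.sqrt s))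
    (dpiece u a xi i r * (y * (- (Num.sqrt t) ^- 2 * (2 * Num.sqrt t)^-1))).
  apply: near_eq_is_derive nt _.
  exact: (@is_derive1_comp _ _ (fun s => y / Num.sqrt s) _ _ _ (is_derive_piece _ _ _ _ _) dt).
have dY := near_eq_is_derive nD dD1.
split.
- by case: dT.
- by have := near_join ny; apply: filterS => z /dw [].
- by case: dY.
rewrite derive1E (@derive_val _ _ _ _ _ _ _ dT) /derive1n /=.
rewrite derive1E (@derive_val _ _ _ _ _ _ _ dY).
rewrite /dpiece /r; field.
by rewrite !gt_eqF.
Unshelve. all: by end_near. Qed.

End Existence.

(** * Existence and uniqueness *)

Section Uniqueness.
Context {R : realType}.
Variables (n : nat) (u a k d : nat -> R).
Hypothesis a0 : forall i, (i <= n)%N -> 0 < a i.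

Lemma self_similar_chain (w : R -> R -> R) (x : nat -> R -> R)
    (xi : nat -> \bar R) (v : R -> R) :
  stefan_solution n u a k d w x ->
  xi 0%N = -oo%E -> (forall i, (i <= n)%N -> (xi i < xi i.+1)%E) ->
  self_similar_profile n u a xi v ->
  (forall i, (1 <= i <= n)%N -> forall t : R, 0 < t ->
     x i t = fine (xi i) * Num.sqrt t) ->
  (forall t y : R, 0 < t -> w t y = v (y / Num.sqrt t)) ->
  chain u a k d n xi.
Proof.
move=> [_ _ stefan _ _] xi0 xi_lt [_ v_node v_piece] xE wE; split=> // i ij.
apply/(stefan_condition_balanced k d a0 xi_lt v_node v_piece xE wE ij ltr01).
exact/stefan.
Qed.

Lemma self_similar_profile_unique (xi xi' : nat -> \bar R) (v v' : R -> R) :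
  xi 0%N = -oo%E -> xi n.+1 = +oo%E ->
  (forall i, (i <= n)%N -> (xi i < xi i.+1)%E) ->
  (forall i, (i <= n.+1)%N -> xi' i = xi i) ->
  self_similar_profile n u a xi v -> self_similar_profile n u a xi' v' -> v' =1 v.
Proof.
move=> xi0 xin xi_lt xixi [_ vn vp] [_ vn' vp'] z.
have [i [ij]] := locate xi0 xin z.
rewrite le_eqVlt => /orP[/eqP xz|xz] zx; last first.
  by rewrite (vp i ij) ?xz// (vp' i ij) !xixi ?xz// leqW.
case: i ij xz zx => [|i] ij xz zx; first by rewrite xi0 in xz.
by have := vn i.+1 ij; have := vn' i.+1 ij; rewrite xixi ?leqW// xz /= => -> ->.
Qed.

End Uniqueness.

Theorem theorem4 (R : realType) (n : nat) (u a k d : nat -> R)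
    (hn : (1 <= n)%N)
    (hu : forall i : nat, (i <= n)%N -> u i < u i.+1)
    (ha : forall i : nat, (i <= n)%N -> 0 < a i)
    (hk : forall i : nat, (i <= n)%N -> 0 < k i)
    (hmin : forall i : nat, (1 <= i <= n)%N ->
       0 <= Num.min (kappa a k i * (u i.+1 - u i))
                    (kappa a k i.-1 * (u i - u i.-1)) + 2 * d i) :
  exists (w : R -> R -> R) (x : nat -> R -> R),
    increasing_self_similar_solution n u a k d w x /\
    forall (w' : R -> R -> R) (x' : nat -> R -> R),
      increasing_self_similar_solution n u a k d w' x' ->
      forall t : R, 0 < t ->
        (forall y : R, w' t y = w t y) /\
        (forall i : nat, (1 <= i <= n)%N -> x' i t = x i t).
Proof.
have m0 i : (i <= n)%N -> 0 < weight u k i.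
  by move=> ij; rewrite mulr_gt0 ?hk// subr_gt0 hu.
have hd i : (1 <= i <= n)%N -> 0 <= weight u k i / a i ^+ 2 + 2 * d i /\
    0 <= weight u k i.-1 / a i.-1 ^+ 2 + 2 * d i.
  move=> /[dup] ij /hmin; have /andP[i1 _] := ij.
  have -> : kappa a k i * (u i.+1 - u i) = weight u k i / a i ^+ 2.
    by rewrite /kappa /weight mulrAC.
  have -> : kappa a k i.-1 * (u i - u i.-1) = weight u k i.-1 / a i.-1 ^+ 2.
    by rewrite /kappa /weight mulrAC prednK.
  by move=> h; split; apply: (le_trans h); rewrite lerD2r ge_min lexx ?orbT.
have [xi [cxi xin uniq]] := full_chain_exists_unique m0 ha hd hn.
have [xi0 xi_lt bal] := cxi.
pose v := profile n u a xi.
pose w (t y : R) : R := v (y / Num.sqrt t).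
pose x (i : nat) (t : R) : R := fine (xi i) * Num.sqrt t.
have node i : (1 <= i <= n)%N -> v (fine (xi i)) = u i.
  move=> ij; have [s xs] := xi_fin xi_lt ij.
  by rewrite xs; exact: (profile_node u ha xi_lt ij xs).
have v_piece i : (i <= n)%N -> forall z, (xi i < z%:E < xi i.+1)%E ->
    v z = piece u a xi i z.
  move=> ij z /andP[xz zx]; apply: (profile_piece u ha xi_lt) => //.
  by rewrite !ltW.
have prof : self_similar_profile n u a xi v.
  by split=> //; exact: profile_continuous.
exists w, x; split.
  split; last by exists xi, v; split.
  split.
  - move=> i ij t t0; rewrite /w /x mulfK ?node//.
    by rewrite gt_eqF// sqrtr_gt0.
  - move=> i ij t y t0 uw; apply: (piece_heat u ha xi_lt) => //.
    exact: (profile_between ha hu xi_lt xi0 xin ij).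
  - move=> i ij t t0.
    by apply/(stefan_condition_balanced k d ha xi_lt node v_piece _ _ ij t0); [| |exact: bal].
  - by move=> y y0; exact: (initial_left ha xi_lt xi0).
  - by move=> y y0; exact: (initial_right ha xi_lt xin).
move=> w' x' [sol [xi' [v' [[xi0' xin' xi_lt'] prof' xE' wE']]]] t t0.
have cxi' := self_similar_chain ha sol xi0' xi_lt' prof' xE' wE'.
have xixi := uniq _ cxi' xin'; split.
  by move=> y; rewrite wE'// (self_similar_profile_unique xi0 xin xi_lt xixi prof prof').
by move=> i /[dup] ij /andP[_ ile]; rewrite xE'// xixi// leqW.
Qed.
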